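(* Let $H$ and $K$ be groups and let $\varphi=\begin{pmatrix}\alpha&\beta\\ \gamma&\delta\end{pmatrix}$ be an endomorphism of $H\times K$. Then the following hold. (1) If $\delta$ is invertible and $\Delta_H=\det_H\varphi$ is invertible, then $$\begin{pmatrix}\Delta_H^{-1} & -\Delta_H^{-1}\beta\delta^{-1}\\ -\delta^{-1}\gamma\Delta_H^{-1} & (1+\delta^{-1}\gamma\Delta_H^{-1}\beta)\delta^{-1}\end{pmatrix}$$ is the inverse of $\varphi$. Moreover, $\det_K(\varphi^{-1})=\delta^{-1}$ and $\det_H\varphi$ is a homomorphism. (2) If $\alpha$ is invertible and $\Delta_K=\det_K\varphi$ is invertible, then $$\begin{pmatrix}(1+\alpha^{-1}\beta\Delta_K^{-1}\gamma)\alpha^{-1} & -\alpha^{-1}\beta\Delta_K^{-1}\\ -\Delta_K^{-1}\gamma\alpha^{-1} & \Delta_K^{-1}\end{pmatrix}$$ is the inverse of $\varphi$. Moreover, $\det_H(\varphi^{-1})=\alpha^{-1}$ and $\det_K\varphi$ is a homomorphism.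
   Context: An endomorphism $\varphi$ of $H\times K$ is identified with the matrix $\begin{pmatrix}\alpha&\beta\\ \gamma&\delta\end{pmatrix}$, where $\alpha\in\operatorname{End}H$, $\beta\in\operatorname{Hom}(K,H)$, $\gamma\in\operatorname{Hom}(H,K)$, $\delta\in\operatorname{End}K$ and $\varphi(h,k)=(\alpha(h)\beta(k),\gamma(h)\delta(k))$ (so the images of $\alpha,\beta$ commute elementwise, and likewise those of $\gamma,\delta$). Functions are composed right-to-left, $(f+g)(x)=f(x)g(x)$, $(-f)(x)=f(x)^{-1}$, $f-g=f+(-g)$, and $1$ denotes an identity map. If $\delta$ is invertible, $\det_H\varphi=\alpha-\beta\delta^{-1}\gamma\colon H\to H$; if $\alpha$ is invertible, $\det_K\varphi=\delta-\gamma\alpha^{-1}\beta\colon K\to K$. Here ''invertible'' means bijective. *)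

(* Defs.v *)
From HB Require Import structures.
From mathcomp Require Import all_boot.
From mathcomp Require Import classical_sets functions.

Set Implicit Arguments.
Unset Strict Implicit.
Unset Printing Implicit Defensive.

Local Open Scope group_scope.

Notation "{ 'hom' G -> H }" := (UMagmaMorphism.type G%type H%type)
  (at level 0, G at level 98, H at level 99,
   format "{ 'hom'  G  ->  H }") : type_scope.

Section FunOps.
Variables G H : groupType.
Implicit Types f g : G -> H.

Definition fun_add f g : G -> H := fun x => f x * g x.

Definition fun_opp f : G -> H := fun x => (f x)^-1.

(* The inverse bijection when [f] is bijective, by [fun_invK] and [fun_invKV]; *)
(* an arbitrary function, hence never to be used, otherwise.                   *)
Definition fun_inv f : H -> G := 'pinv_(fun=> 1) [set: G]%classic f.

Lemma fun_invK f : bijective f -> cancel f (fun_inv f).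
Proof.
move=> /bij_inj f_inj x; apply: pinvKV; first by move=> ? ? _ _; apply: f_inj.
by rewrite inE.
Qed.

Lemma fun_invKV f : bijective f -> cancel (fun_inv f) f.
Proof.
move=> [g _ gK] y; apply: pinvK.
by apply/mem_set; exists (g y).
Qed.

End FunOps.

Declare Scope gfun_scope.
Delimit Scope gfun_scope with GF.
Notation "1" := idfun : gfun_scope.
Notation "f + g" := (fun_add f%GF g%GF) : gfun_scope.
Notation "- f" := (fun_opp f%GF) : gfun_scope.
Notation "f - g" := (fun_add f%GF (fun_opp g%GF)) : gfun_scope.
Notation "f ^-1" := (fun_inv f%GF) : gfun_scope.
Notation "f \o g" := (comp f%GF g%GF) : gfun_scope.

(* [is_mx phi a b c d]: the endomorphism [phi] is identified with the matrix   *)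
(* ((a, b), (c, d)).  The entries are mere functions, so that being            *)
(* homomorphisms is part of the assertion.                                     *)
Definition is_mx (H K : groupType) (phi : {hom H * K -> H * K})
    (a : H -> H) (b : K -> H) (c : H -> K) (d : K -> K) : Prop :=
  [/\ [/\ monoid_morphism a, monoid_morphism b,
          monoid_morphism c & monoid_morphism d]
    & forall h k, phi (h, k) = (a h * b k, c h * d k)].

Section Entries.
Variables (H K : groupType) (phi : {hom H * K -> H * K}).

Definition mxHH : H -> H := fun h => (phi (h, 1)).1.
Definition mxHK : K -> H := fun k => (phi (1, k)).1.
Definition mxKH : H -> K := fun h => (phi (h, 1)).2.
Definition mxKK : K -> K := fun k => (phi (1, k)).2.

Lemma is_mx_entries : is_mx phi mxHH mxHK mxKH mxKK.
Proof.
split=> [|h k].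
  rewrite /mxHH /mxHK /mxKH /mxKK; split; split; rewrite ?gmulf1 // => x y.
  - by rewrite -[x * y]/((x, y).1 * (x, y).2) -[RHS]/((_ * _ : H * K).1)
      -gmulfM; congr (phi (_, _)).1; rewrite /= mulg1.
  - by rewrite -[RHS]/((_ * _ : H * K).1) -gmulfM;
      congr (phi (_, _)).1; rewrite /= mulg1.
  - by rewrite -[RHS]/((_ * _ : H * K).2) -gmulfM;
      congr (phi (_, _)).2; rewrite /= mulg1.
  - by rewrite -[RHS]/((_ * _ : H * K).2) -gmulfM;
      congr (phi (_, _)).2; rewrite /= mulg1.
have -> : (h, k) = (h, 1) * (1, k) :> H * K.
  by congr (_, _); rewrite /= ?mulg1 ?mul1g.
by rewrite gmulfM.
Qed.

Lemma is_mx_uniq a b c d : is_mx phi a b c d ->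
  [/\ mxHH =1 a, mxHK =1 b, mxKH =1 c & mxKK =1 d].
Proof.
move=> [[[a1 _] [b1 _] [c1 _] [d1 _]] phiE].
by split=> x; rewrite /mxHH /mxHK /mxKH /mxKK phiE /= ?a1 ?b1 ?c1 ?d1
  ?mulg1 ?mul1g.
Qed.

Lemma is_mx_commute a b c d : is_mx phi a b c d ->
  (forall h k, commute (a h) (b k)) /\ (forall h k, commute (c h) (d k)).
Proof.
move=> [[[a1 _] [b1 _] [c1 _] [d1 _]] phiE].
have E h k : phi (h, k) = phi (1, k) * phi (h, 1).
  by rewrite -gmulfM; congr (phi (_, _)); rewrite /= ?mulg1 ?mul1g.
split=> h k; move: (E h k); rewrite !phiE a1 b1 c1 d1 !mul1g !mulg1;
  by case.
Qed.

Definition detH : H -> H := (mxHH - (mxHK \o mxKK^-1 \o mxKH))%GF.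

Definition detK : K -> K := (mxKK - (mxKH \o mxHH^-1 \o mxHK))%GF.

End Entries.

(* Main.v *)
Require Import Defs.
From HB Require Import structures.
From mathcomp Require Import all_boot.

Set Implicit Arguments.
Unset Strict Implicit.
Unset Printing Implicit Defensive.

(* Surjectivity of delta makes im gamma central in K; then im beta commutes    *)
(* with the image of the surjection Delta_H, so it is central in H.  Hence     *)
(* Delta_H is a homomorphism, and solving phi (h, k) = (x, y) by elimination   *)
(* of k gives the stated matrix.  Part (2) is part (1) for the endomorphism of *)
(* K * H obtained by exchanging the factors.                                   *)

Local Open Scope group_scope.

(** The mechanism is centrality. The images of gamma and delta commute, so surjectivity of delta
    makes the image of gamma central ([gamma_central]), and surjectivity of [detH phi] then does the
    same for beta ([beta_central]). Terms can now be moved and cancelled as for a Schur complement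
    over a ring: [detH phi] is multiplicative ([detH_morphism]), the stated matrix is a right
    inverse ([inv_mxKV]), and the trivial kernel ([phi_inj]) makes it two-sided. *)

Lemma fun_inv_bij (G H : groupType) (f : G -> H) :
  bijective f -> bijective (fun_inv f).
Proof.
by move=> f_bij; exists f; [apply: fun_invKV | apply: fun_invK].
Qed.

(** Lets delta replace [mxKK phi], which agrees with it only pointwise, under the inverse in
    [detH]. *)
Lemma eq_fun_inv (G H : groupType) (f g : G -> H) :
  bijective f -> f =1 g -> fun_inv f =1 fun_inv g.
Proof.
move=> f_bij fg x; have g_bij := eq_bij f_bij fg.
by apply: (bij_inj f_bij); rewrite fun_invKV // fg fun_invKV.
Qed.

Lemma fun_inv_morphism (G H : groupType) (f : G -> H) :
  bijective f -> monoid_morphism f -> monoid_morphism (fun_inv f).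
Proof.
move=> f_bij [f1 fM]; split=> [|x y]; apply: (bij_inj f_bij).
  by rewrite fun_invKV.
by rewrite fM !fun_invKV.
Qed.

Lemma eq_monoid_morphism (G H : groupType) (f g : G -> H) :
  f =1 g -> monoid_morphism f -> monoid_morphism g.
Proof. by move=> fg [f1 fM]; split=> [|x y]; rewrite -!fg. Qed.

Lemma detHE (H K : groupType) (phi : {hom H * K -> H * K}) a b c d :
  is_mx phi a b c d -> bijective d ->
  detH phi =1 (a - (b \o d^-1 \o c))%GF.
Proof.
move=> /is_mx_uniq[aE bE cE dE] d_bij h.
have dVE := eq_fun_inv d_bij (fsym dE).
by rewrite /detH /fun_add /fun_opp /= aE bE cE -dVE.
Qed.

Lemma hom_morphism (G H : groupType) (f : {hom G -> H}) : monoid_morphism f.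
Proof. by split; [apply: gmulf1 | apply: gmulfM]. Qed.

Section SwapFactors.
Variables (H K : groupType) (f : H * K -> H * K).

(** Conjugation by the exchange of factors; [detH] of the conjugate is convertible to [detK] of the
    original. *)
Definition swap_fun (p : K * H) : K * H := ((f (p.2, p.1)).2, (f (p.2, p.1)).1).

Lemma swap_fun_morphism : monoid_morphism f -> monoid_morphism swap_fun.
Proof.
move=> [f1 fM]; split=> [|[x1 x2] [y1 y2]].
  by rewrite /swap_fun -[f _]/(f 1) f1.
by rewrite /swap_fun -[f _]/(f ((x2, x1) * (y2, y1))) fM.
Qed.

End SwapFactors.

Definition swap_hom (H K : groupType) (phi : {hom H * K -> H * K}) :
    {hom K * H -> K * H} :=
  HB.pack (swap_fun phi) (isUMagmaMorphism.Build _ _ (swap_fun phi)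
    (swap_fun_morphism (hom_morphism phi))).

Lemma is_mx_swap (H K : groupType) (phi : {hom H * K -> H * K}) a b c d :
  is_mx phi a b c d -> is_mx (swap_hom phi) d c b a.
Proof.
move=> mx; have [ab cd] := is_mx_commute mx.
case: mx => [[am bm cm dm] phiE]; split=> // k h.
(* The exchange reverses the two factors in each coordinate; they commute. *)
by rewrite /= /swap_fun phiE /= ab cd.
Qed.

Lemma swap_fun_can (H K : groupType) (f g : H * K -> H * K) :
  cancel f g -> cancel (swap_fun f) (swap_fun g).
Proof. by move=> fK [k h]; rewrite /swap_fun /= -surjective_pairing fK. Qed.

Lemma swap_funK (H K : groupType) (f : H * K -> H * K) :
  swap_fun (swap_fun f) =1 f.
Proof. by move=> p; rewrite /swap_fun /= -!surjective_pairing. Qed.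

Lemma detKE (H K : groupType) (phi : {hom H * K -> H * K}) a b c d :
  is_mx phi a b c d -> bijective a ->
  detK phi =1 (d - (c \o a^-1 \o b))%GF.
Proof. by move=> /is_mx_swap; apply: detHE. Qed.

Section InverseByDetH.
Variables (H K : groupType) (phi : {hom H * K -> H * K}).
Variables (alpha : {hom H -> H}) (beta : {hom K -> H}).
Variables (gamma : {hom H -> K}) (delta : {hom K -> K}).
Hypothesis phi_mx : is_mx phi alpha beta gamma delta.
Hypothesis delta_bij : bijective delta.
Hypothesis D_bij : bijective (detH phi).

Local Notation D := (detH phi).
Local Notation di := (fun_inv delta).
Local Notation Di := (fun_inv D).

Let phiE h k : phi (h, k) = (alpha h * beta k, gamma h * delta k).
Proof. by case: phi_mx. Qed.

Let DE h : D h = alpha h * (beta (di (gamma h)))^-1.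
Proof. exact: detHE. Qed.

Let diK : cancel delta di. Proof. exact: fun_invK. Qed.
Let diKV : cancel di delta. Proof. exact: fun_invKV. Qed.
Let DiK : cancel D Di. Proof. exact: fun_invK. Qed.
Let DiKV : cancel Di D. Proof. exact: fun_invKV. Qed.

Let di_morph : monoid_morphism di.
Proof. by apply: fun_inv_morphism => //; apply: hom_morphism. Qed.

Lemma gamma_central h k : commute (gamma h) k.
Proof. by rewrite -[k]diKV; apply: (is_mx_commute phi_mx).2. Qed.

Lemma di_gamma_central h k : commute (di (gamma h)) k.
Proof.
by rewrite /commute -[k]diK -!di_morph.2 gamma_central.
Qed.

(** Each h is a value of D, hence a value of alpha times the inverse of beta at a central element of
    K; [beta k] commutes with both. *)
Lemma beta_central k h : commute (beta k) h.
Proof.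
rewrite -[h]DiKV DE; apply: commuteM.
  exact/commute_sym/(is_mx_commute phi_mx).1.
by apply/commuteV/gmulf_commute/commute_sym/di_gamma_central.
Qed.

Lemma detH_morphism : monoid_morphism D.
Proof.
split=> [|x y]; first by rewrite DE !gmulf1 di_morph.1 gmulf1 mulgV.
rewrite !DE !gmulfM di_morph.2 gmulfM invgM -!mulgA; congr (_ * _).
by rewrite mulgA; apply/commuteV/commute_sym/beta_central.
Qed.

Let Di_morph : monoid_morphism Di.
Proof. exact: fun_inv_morphism detH_morphism. Qed.

Definition inv_mx (p : H * K) : H * K :=
  (Di p.1 * (Di (beta (di p.2)))^-1,
   (di (gamma (Di p.1)))^-1 * (di p.2 * di (gamma (Di (beta (di p.2)))))).

Lemma inv_mxKV : cancel inv_mx phi.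
Proof.
move=> [x y]; rewrite phiE /=.
set a := Di x; set s := Di (beta (di y)).
have aE : alpha a * (beta (di (gamma a)))^-1 = x by rewrite -DE DiKV.
have sE : alpha s * (beta (di (gamma s)))^-1 = beta (di y) by rewrite -DE DiKV.
congr (_, _).
  (* By [sE], the factors [beta (di y)] and [beta (di (gamma s))] multiply to [alpha s], which
     cancels its inverse across a central value of beta. *)
  rewrite !gmulfM !gmulfV -sE mulgVK -[RHS]aE -!mulgA; congr (_ * _).
  have /commute_sym/commuteV/commute_sym-> :=
    beta_central (di (gamma a)) (alpha s).
  exact: mulKg.
rewrite !gmulfM !gmulfV !diKV (gamma_central a) -(gamma_central s y).
by rewrite -mulgA mulVKg mulKg.
Qed.

(** On the kernel, the second coordinate determines k from h, and substituting it turns the first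
    coordinate into [D h]. *)
Lemma phi_inj : injective phi.
Proof.
apply: gmulf_inj => -[h k]; rewrite phiE => -[].
move=> hE kE; have kE' : k = (di (gamma h))^-1.
  by apply/esym/mulg1_eq; rewrite -[k]diK -di_morph.2 kE di_morph.1.
have h1 : h = 1.
  by apply: (bij_inj D_bij); rewrite detH_morphism.1 DE -gmulfV -kE'.
by rewrite kE' h1 gmulf1 di_morph.1 invg1.
Qed.

Lemma inv_mxK : cancel phi inv_mx.
Proof. exact: inj_can_sym inv_mxKV phi_inj. Qed.

Lemma inv_mx_morphism : monoid_morphism inv_mx.
Proof.
split; first exact: can2_gmulf1 inv_mxK inv_mxKV.
exact: can2_gmulfM inv_mxK inv_mxKV.
Qed.

Definition inv_mx_hom : {hom H * K -> H * K} :=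
  HB.pack inv_mx (isUMagmaMorphism.Build _ _ inv_mx inv_mx_morphism).

Lemma inv_mx_is_mx :
  is_mx inv_mx_hom (D^-1)%GF (- (D^-1 \o beta \o delta^-1))%GF
    (- (delta^-1 \o gamma \o D^-1))%GF
    ((1 + (delta^-1 \o gamma \o D^-1 \o beta)) \o delta^-1)%GF.
Proof.
(* The entries are components of restrictions of an endomorphism, so their multiplicativity needs no
   computation. *)
have [[ma mb mc md] _] := is_mx_entries inv_mx_hom.
split=> //; split.
- exact: Di_morph.
- apply: eq_monoid_morphism mb => k.
  by rewrite /mxHK /= Di_morph.1 mul1g.
- apply: eq_monoid_morphism mc => h.
  by rewrite /mxKH /= di_morph.1 gmulf1 Di_morph.1 gmulf1 di_morph.1 !mulg1.
- apply: eq_monoid_morphism md => k.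
  by rewrite /mxKK /= Di_morph.1 gmulf1 di_morph.1 invg1 mul1g.
Qed.

(** Ensures that the inverse inside [detK inv_mx_hom] is a genuine one. *)
Lemma inv_mx_HH_bij : bijective (mxHH inv_mx_hom).
Proof.
have [DiE _ _ _] := is_mx_uniq inv_mx_is_mx.
exact: eq_bij (fun_inv_bij D_bij) _ (fsym DiE).
Qed.

Lemma detK_inv_mx : detK inv_mx_hom =1 di.
Proof.
move=> y; rewrite (detKE inv_mx_is_mx (fun_inv_bij D_bij)).
have DiVE z : fun_inv Di z = D z.
  by apply: (bij_inj (fun_inv_bij D_bij)); rewrite fun_invKV ?DiK //;
    apply: fun_inv_bij.
rewrite /fun_add /fun_opp /= DiVE DiK invgK -mulgA.
by rewrite -di_morph.2 -gmulfM mulgV gmulf1 di_morph.1 mulg1.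
Qed.

End InverseByDetH.


Theorem proposition3p1 (H K : groupType)
  (phi : {hom H * K -> H * K})
  (alpha : {hom H -> H}) (beta : {hom K -> H})
  (gamma : {hom H -> K}) (delta : {hom K -> K}) :
  is_mx phi alpha beta gamma delta ->
  (bijective delta -> bijective (detH phi) ->
     let D := detH phi in
     (exists psi : {hom H * K -> H * K},
       [/\ cancel phi psi, cancel psi phi,
           is_mx psi
             (D^-1)%GF
             (- (D^-1 \o beta \o delta^-1))%GF
             (- (delta^-1 \o gamma \o D^-1))%GF
             ((1 + (delta^-1 \o gamma \o D^-1 \o beta)) \o delta^-1)%GF,
           bijective (mxHH psi)
         & detK psi =1 (delta^-1)%GF])
     /\ monoid_morphism D)
  /\
  (bijective alpha -> bijective (detK phi) ->
     let D := detK phi in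
     (exists psi : {hom H * K -> H * K},
       [/\ cancel phi psi, cancel psi phi,
           is_mx psi
             ((1 + (alpha^-1 \o beta \o D^-1 \o gamma)) \o alpha^-1)%GF
             (- (alpha^-1 \o beta \o D^-1))%GF
             (- (D^-1 \o gamma \o alpha^-1))%GF
             (D^-1)%GF,
           bijective (mxKK psi)
         & detH psi =1 (alpha^-1)%GF])
     /\ monoid_morphism D).
Proof.
move=> phi_mx; split=> [delta_bij D_bij | alpha_bij D_bij] /=.
  split; last exact: detH_morphism phi_mx delta_bij D_bij.
  exists (inv_mx_hom phi_mx delta_bij D_bij); split.
  - exact: inv_mxK phi_mx delta_bij D_bij.
  - exact: inv_mxKV phi_mx delta_bij D_bij.
  - exact: inv_mx_is_mx phi_mx delta_bij D_bij.
  - exact: inv_mx_HH_bij phi_mx delta_bij D_bij.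
  - exact: detK_inv_mx phi_mx delta_bij D_bij.
have phi_mx' := is_mx_swap phi_mx.
split; last exact: detH_morphism phi_mx' alpha_bij D_bij.
set psi := inv_mx_hom phi_mx' alpha_bij D_bij.
exists (swap_hom psi); split.
- have psiK := inv_mxK phi_mx' alpha_bij D_bij.
  exact: eq_can (swap_fun_can psiK) (swap_funK phi) (frefl _).
- have psiKV := inv_mxKV phi_mx' alpha_bij D_bij.
  exact: eq_can (swap_fun_can psiKV) (frefl _) (swap_funK phi).
- exact: is_mx_swap (inv_mx_is_mx phi_mx' alpha_bij D_bij).
(* [mxKK (swap_hom psi)] is convertible to [mxHH psi]. *)
- exact: inv_mx_HH_bij phi_mx' alpha_bij D_bij.
- exact: detK_inv_mx phi_mx' alpha_bij D_bij.
Qed.
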